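(* For the complete bipartite graph $K_{r,s}$ with $2\le r\le s$, the edge coalition number satisfies $EC(K_{r,s})\ge 2s$.
   Context: Graphs are finite and simple. Two distinct edges are adjacent if they share an endpoint. A set $D\subseteq E$ is an edge-dominating set of $G=(V,E)$ if every edge in $E\setminus D$ is adjacent to an edge of $D$. Two disjoint sets of edges $E_1,E_2$ form an edge coalition if neither is an edge-dominating set but $E_1\cup E_2$ is. An $ec$-partition of $G$ is a partition $\pi=\{E_1,\ldots,E_k\}$ of $E$ into nonempty sets such that every $E_i$ is either a singleton edge-dominating set, or is not an edge-dominating set but forms an edge coalition with another set $E_j$ of $\pi$. The edge coalition number $EC(G)$ is the maximum order $k$ of an $ec$-partition of $G$. *)

(* Defs.v *)
From mathcomp Require Import all_boot.

Set Implicit Arguments.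
Unset Strict Implicit.
Unset Printing Implicit Defensive.

Record sgraph := SGraph {
  vertex :> finType;
  adj : rel vertex;
  adj_sym : symmetric adj;
  adj_irrefl : irreflexive adj
}.

(* Edges are the two-element sets of their endpoints. *)
Definition edges (G : sgraph) : {set {set G}} :=
  [set [set p.1; p.2] | p : G * G & adj p.1 p.2].

Definition edge_adjacent (G : sgraph) (e f : {set G}) : bool :=
  (e != f) && [exists v : G, (v \in e) && (v \in f)].

Definition edge_dominating (G : sgraph) (D : {set {set G}}) : bool :=
  (D \subset edges G) &&
  [forall e in edges G :\: D, exists f in D, edge_adjacent e f].

Definition edge_coalition (G : sgraph) (A B : {set {set G}}) : bool :=
  [&& A \subset edges G, B \subset edges G, [disjoint A & B],
      ~~ edge_dominating A, ~~ edge_dominating B & edge_dominating (A :|: B)].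

(* [partition] already requires the blocks to be nonempty. *)
Definition ec_partition (G : sgraph) (P : {set {set {set G}}}) : bool :=
  partition P (edges G) &&
  [forall A in P,
     ((#|A| == 1) && edge_dominating A)
     || (~~ edge_dominating A &&
         [exists B in P, (B != A) && edge_coalition A B])].

(* The maximum is 0 when [G] has no ec-partition. *)
Definition EC (G : sgraph) : nat :=
  \max_(P : {set {set {set G}}} | ec_partition P) #|P|.

Definition Krs_adj (r s : nat) : rel ('I_r + 'I_s) :=
  fun x y => match x, y with
             | inl _, inr _ | inr _, inl _ => true
             | _, _ => false
             end.

Lemma Krs_adj_sym (r s : nat) : symmetric (@Krs_adj r s).
Proof. by case=> [i|i] [j|j]. Qed.

Lemma Krs_adj_irrefl (r s : nat) : irreflexive (@Krs_adj r s).
Proof. by case. Qed.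

Definition complete_bipartite (r s : nat) : sgraph :=
  SGraph (@Krs_adj_sym r s) (@Krs_adj_irrefl r s).

(* Main.v *)
Require Import Defs.
From mathcomp Require Import all_boot.

(** The edges of K_{r,s} at a fixed vertex [j] of the side of size [s] form a
    star. The star is an edge-dominating set, because it meets every vertex of
    the other side and every edge has an endpoint there. Fix a nonempty proper
    subset [X] of the side of size [r], which exists because [1 < r], and cut
    each of the [s] stars into the edges that go to [X] and the edges that go to
    the complement of [X]. Neither half is dominating: it misses a vertex on the
    left, and, since [1 < s], it also misses a vertex on the right, so the edge
    joining these two is adjacent to nothing in the half
    ([halfstar_not_dominating]). The two halves of a star together dominate
    ([halfstars_dominating]), so they form a coalition. The [2 * s] half-stars
    are thus the blocks of an ec-partition. *)

Section CompleteBipartite.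

Variables r s : nat.
Local Notation K := (complete_bipartite r s).
Implicit Types (i : 'I_r) (j : 'I_s) (X : {set 'I_r}).

Definition Kedge i j : {set K} := [set inl i; inr j].

Lemma inl_Kedge i i' j : ((inl i : K) \in Kedge i' j) = (i == i').
Proof. by rewrite in_set2 orbF. Qed.

Lemma inr_Kedge i j j' : ((inr j : K) \in Kedge i j') = (j == j').
Proof. by rewrite in_set2. Qed.

Lemma Kedge_inj i j i' j' : Kedge i j = Kedge i' j' -> i = i' /\ j = j'.
Proof.
move=> eq_e; split; apply/eqP.
  by rewrite -(inl_Kedge _ _ j') -eq_e inl_Kedge.
by rewrite -(inr_Kedge i') -eq_e inr_Kedge.
Qed.

Lemma edgesKP (e : {set K}) :
  reflect (exists i j, e = Kedge i j) (e \in edges K).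
Proof.
apply: (iffP imsetP) => [[[x y]] | [i [j ->]]]; last first.
  by exists (inl i, inr j); rewrite ?inE.
rewrite inE; case: x y => [i|j] [i'|j'] //= _ ->; first by exists i, j'.
by exists i', j; rewrite setUC.
Qed.

Lemma edge_adjacent_Kedge i j i' j' :
  edge_adjacent (Kedge i j) (Kedge i' j') =
    (Kedge i j != Kedge i' j') && ((i == i') || (j == j')).
Proof.
rewrite /edge_adjacent; congr (_ && _); apply/existsP/orP.
  case=> [[k|k]]; rewrite ?inl_Kedge ?inr_Kedge => /andP[/eqP <- ->]; by auto.
case=> eq_v; [exists (inl i) | exists (inr j)];
  by rewrite ?inl_Kedge ?inr_Kedge eqxx eq_v.
Qed.

Definition halfstar X j : {set {set K}} := [set Kedge i j | i in X].

Lemma mem_halfstar X j i j' :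
  (Kedge i j' \in halfstar X j) = (i \in X) && (j' == j).
Proof.
apply/imsetP/andP => [[i' Xi' /Kedge_inj[-> ->]] | [Xi /eqP->]] //.
by exists i.
Qed.

Lemma halfstar_sub X j : halfstar X j \subset edges K.
Proof. by apply/subsetP => _ /imsetP[i _ ->]; apply/edgesKP; exists i, j. Qed.

(** For [i] outside [X] and [j'] other than [j], the edge [i j'] has no endpoint
    in common with an edge from [X] to [j]. *)
Lemma halfstar_not_dominating X j :
  1 < s -> X != setT -> ~~ edge_dominating (halfstar X j).
Proof.
move=> s_gt1; rewrite -subTset => /subsetPn[i _ X'i].
have /card_gt0P[j' jj'] : 0 < #|[set~ j]|.
  by rewrite cardsC1 card_ord -subn1 subn_gt0.
rewrite !inE in jj'; apply/negP => /andP[_ /forall_inP/(_ (Kedge i j'))].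
rewrite inE mem_halfstar (negPf X'i) /=.
have -> : Kedge i j' \in edges K by apply/edgesKP; exists i, j'.
case/(_ isT)/exists_inP => _ /imsetP[i' Xi' ->].
rewrite edge_adjacent_Kedge (negPf jj') orbF => /andP[_ /eqP ii'].
by rewrite ii' Xi' in X'i.
Qed.

(** The union is the full star at [j], so the edge [i j'] is adjacent to [i j]
    unless the two coincide. *)
Lemma halfstars_dominating X j :
  edge_dominating (halfstar X j :|: halfstar (~: X) j).
Proof.
have starP i : Kedge i j \in halfstar X j :|: halfstar (~: X) j.
  by rewrite !inE !mem_halfstar inE eqxx !andbT orbN.
rewrite /edge_dominating subUset !halfstar_sub /=.
apply/forall_inP => e /setDP[/edgesKP[i [j' ->]] notD].
apply/exists_inP; exists (Kedge i j); first exact: starP.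
rewrite edge_adjacent_Kedge eqxx andbT.
by apply: contraNneq notD => ->; apply: starP.
Qed.

Lemma halfstars_disjoint X j : [disjoint halfstar X j & halfstar (~: X) j].
Proof.
apply/pred0P => e /=; apply/negP => /andP[/imsetP[i Xi ->]].
by rewrite mem_halfstar inE Xi.
Qed.

Lemma halfstars_coalition X j :
    1 < s -> X != setT -> X != set0 ->
  edge_coalition (halfstar X j) (halfstar (~: X) j).
Proof.
move=> s_gt1 XnT Xn0; rewrite /edge_coalition !halfstar_sub.
rewrite halfstars_disjoint halfstars_dominating !halfstar_not_dominating //.
by rewrite -setC0 (inj_eq (@setC_inj _)).
Qed.

(** Indexing [X] and its complement by a Boolean makes [i \in X] itself the
    index of the side of [i]; this is what gives each edge exactly one block in
    [mem_sidestar], from which covering and disjointness both follow. *)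
Definition side X (b : bool) : {set 'I_r} := if b then X else ~: X.

Lemma mem_side X b i : (i \in side X b) = ((i \in X) == b).
Proof. by case: b; rewrite /side ?inE ?eqb_id ?eqbF_neg. Qed.

Lemma sideC X b : ~: side X b = side X (~~ b).
Proof. by case: b; rewrite /side /= ?setCK. Qed.

Lemma side_neqT X b : X != setT -> X != set0 -> side X b != setT.
Proof. by case: b; rewrite /side // -setC0 (inj_eq (@setC_inj _)). Qed.

Lemma side_neq0 X b : X != setT -> X != set0 -> side X b != set0.
Proof. by case: b; rewrite /side // -setCT (inj_eq (@setC_inj _)). Qed.

Definition sidestar X (p : 'I_s * bool) : {set {set K}} :=
  halfstar (side X p.2) p.1.

Definition sidestars X : {set {set {set K}}} :=
  [set sidestar X p | p in {: 'I_s * bool}].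

Lemma mem_sidestar X p i j :
  (Kedge i j \in sidestar X p) = (p == (j, i \in X)).
Proof.
case: p => j' b; rewrite mem_halfstar mem_side xpair_eqE andbC.
by rewrite (eq_sym j') (eq_sym b).
Qed.

Lemma cover_sidestars X : cover (sidestars X) = edges K.
Proof.
apply/eqP; rewrite eqEsubset; apply/andP; split.
  by apply/bigcupsP => _ /imsetP[p _ ->]; apply: halfstar_sub.
apply/subsetP => _ /edgesKP[i [j ->]]; apply/bigcupP.
exists (sidestar X (j, i \in X)); first exact: imset_f.
by rewrite mem_sidestar.
Qed.

Lemma sidestars_partition X :
    X != setT -> X != set0 ->
  partition (sidestars X) (edges K) /\ #|sidestars X| = 2 * s.
Proof.
move=> XnT Xn0.
have disj : {in {: 'I_s * bool} &,
    forall p q, q != p -> [disjoint sidestar X p & sidestar X q]}.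
  move=> p q _ _ neq_qp; apply/pred0P => e /=; apply/negP => /andP[sp].
  have /edgesKP[i [j def_e]] := subsetP (halfstar_sub _ _) _ sp.
  move: sp; rewrite def_e !mem_sidestar => /eqP def_p /eqP def_q.
  by rewrite def_p def_q eqxx in neq_qp.
have nonempty p : p \in {: 'I_s * bool} -> sidestar X p != set0.
  case: p => j b _; have /set0Pn[i bi] := side_neq0 _ b XnT Xn0.
  by apply/set0Pn; exists (Kedge i j); rewrite mem_halfstar bi eqxx.
have [] := indexed_partition disj nonempty.
rewrite cover_sidestars => partP injB; split=> //.
by rewrite card_in_imset // card_prod card_ord card_bool mulnC.
Qed.

(** The partner of a half-star is the other half of the same star. *)
Lemma sidestars_ec_partition X :
  1 < s -> X != setT -> X != set0 -> ec_partition (sidestars X).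
Proof.
move=> s_gt1 XnT Xn0; have [partP _] := sidestars_partition _ XnT Xn0.
rewrite /ec_partition partP /=; apply/forall_inP => _ /imsetP[[j b] _ ->].
have [bnT bn0] := (side_neqT _ b XnT Xn0, side_neq0 _ b XnT Xn0).
have coal := halfstars_coalition _ j s_gt1 bnT bn0.
rewrite {1 2}/sidestar /= [X in _ || X]andbC halfstar_not_dominating // andbT.
apply/orP; right; apply/exists_inP; exists (sidestar X (j, ~~ b)).
  exact: imset_f.
rewrite /sidestar /= -sideC coal andbT.
(* The half-stars are distinct since they are disjoint and nonempty. *)
have /set0Pn[i bi] := bn0; apply/eqP => /setP/(_ (Kedge i j)).
by rewrite !mem_halfstar inE bi eqxx.
Qed.

End CompleteBipartite.

Theorem proposition4p9 (r s : nat) (hr : 2 <= r) (hrs : r <= s) :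
  2 * s <= EC (complete_bipartite r s).
Proof.
pose X := [set Ordinal (ltnW hr)].
have XnT : X != setT.
  by rewrite eqEcard cards1 cardsT card_ord leqNgt hr andbF.
have Xn0 : X != set0 by rewrite -card_gt0 cards1.
have [_ <-] := sidestars_partition _ s _ XnT Xn0.
apply: leq_bigmax_cond; apply: sidestars_ec_partition => //.
exact: leq_trans hrs.
Qed.
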